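(* Let $\beta$ be a Salem number and let $(n_i)_{i=0}^\infty$ be an integer-valued linear recurrent sequence with characteristic polynomial the minimal polynomial of $\beta$ over $\mathbb{Q}$. Then the set $\{ n_i \mid i \in \mathbb{N}_0\}\subseteq \mathbb{Z}$ is generalised polynomial.
   Context: $\mathbb{N}_0=\{0,1,2,\dots\}$. The class of generalised polynomial maps $\mathbb{Z}\to\mathbb{R}$ is the smallest class of functions $\mathbb{Z}\to\mathbb{R}$ that contains all real constants and the identity $n\mapsto n$ and is closed under pointwise addition, pointwise multiplication, and replacing $f$ by $\lfloor f\rfloor$, $\lfloor f\rfloor(n)=\lfloor f(n)\rfloor$. A set $E\subseteq\mathbb{Z}$ is generalised polynomial if its characteristic function $1_E\colon\mathbb{Z}\to\{0,1\}$ is a generalised polynomial map. A conjugate of an algebraic number is any complex root of its minimal polynomial over $\mathbb{Q}$. A Salem number is a real algebraic integer $\beta>1$ such that all conjugates $\alpha\ne\beta$ of $\beta$ satisfy $|\alpha|\le 1$ and at least one conjugate satisfies $|\alpha|=1$. A sequence $(n_i)_{i=0}^\infty$ is linear recurrent with characteristic polynomial $X^m-\sum_{j=0}^{m-1}a_jX^j$ if $n_{i+m}=\sum_{j=0}^{m-1}a_jn_{i+j}$ for all $i\ge 0$. *)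

(* Defs.v *)
From HB Require Import structures.
From mathcomp Require Import all_boot all_order all_algebra.
From mathcomp Require Import all_classical all_reals.
From mathcomp Require Import numfun.
From mathcomp Require Import complex.

Set Implicit Arguments.
Unset Strict Implicit.
Unset Printing Implicit Defensive.

Import Order.TTheory GRing.Theory Num.Theory.
Local Open Scope classical_set_scope.
Local Open Scope ring_scope.
Local Open Scope complex_scope.

(* The smallest class containing the constants and the identity that is closed
   under +, * and floor.  Closure under pointwise equality of functions is not
   a separate rule: it follows from functional extensionality. *)
Inductive gen_poly (R : realType) : (int -> R) -> Prop :=
| gen_poly_const (c : R) : gen_poly (fun _ => c)
| gen_poly_id : gen_poly (fun k => k%:~R)
| gen_poly_add (f g : int -> R) :
    gen_poly f -> gen_poly g -> gen_poly (fun k => f k + g k)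
| gen_poly_mul (f g : int -> R) :
    gen_poly f -> gen_poly g -> gen_poly (fun k => f k * g k)
| gen_poly_floor (f : int -> R) :
    gen_poly f -> gen_poly (fun k => (Num.floor (f k))%:~R).

Definition gen_poly_set (R : realType) (E : set int) : Prop :=
  gen_poly (\1_E : int -> R).

(* A relation rather than a function: a transcendental x has no minimal
   polynomial, and an algebraic x has exactly one. *)
Definition is_min_poly (K : numFieldType) (x : K) (p : {poly rat}) : Prop :=
  [/\ p \is monic,
      root (map_poly ratr p) x &
      forall q : {poly rat}, q != 0 -> root (map_poly ratr q) x ->
        (size p <= size q)%N].

Definition conjugate (R : realType) (x : R) (z : R[i]) : Prop :=
  exists2 p : {poly rat}, is_min_poly x p & root (map_poly ratr p) z.

Definition salem (R : realType) (beta : R) : Prop :=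
  [/\ integralOver (intr : int -> R) beta,
      1 < beta,
      forall z : R[i], conjugate beta z -> z != beta%:C -> `|z| <= 1 &
      exists2 z : R[i], conjugate beta z & `|z| = 1].

(* m and a are determined by p, so the existential only names the degree and
   the coefficients of p. *)
Definition linear_recurrent (F : fieldType) (p : {poly F}) (u : nat -> F) :
    Prop :=
  exists (m : nat) (a : 'I_m -> F),
    p = 'X^m - \sum_(j < m) a j *: 'X^j /\
    forall i : nat, u (i + m)%N = \sum_(j < m) a j * u (i + j)%N.

(* Main.v *)
Require Import Defs.
From HB Require Import structures.
From mathcomp Require Import all_boot all_order all_algebra.
From mathcomp Require Import all_classical all_reals.
From mathcomp Require Import numfun separable qpoly complex.
From mathcomp Require Import ring lra zify.

(** Let P be the minimal polynomial of beta, an integer polynomial of degree d.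
    Its roots are beta, 1/beta and numbers of modulus one
    ([salem_reciprocal], [salem_conjugates]): a root z of modulus one has
    1/z as its conjugate, so P is self-reciprocal.

    Whether an integer k is a term of the sequence is decided in two steps.

    Recovering the state.  Writing n(i) as a combination of i-th powers of the
    roots of P, all of which but beta have modulus at most one, shows that
    n(i + j) - beta^j n(i) is bounded ([growth_bound]).  So n(i + j) is
    floor(beta^j n(i)) plus an error from a finite set, and for each choice of
    the d errors the state (n(i), ..., n(i + d - 1)) is a generalised
    polynomial function of the integer n(i).  The coordinates of beta^i in the
    basis 1, beta, ..., beta^(d-1) are fixed linear forms in that state, because
    the Hankel matrix of a nonzero solution is invertible ([hankel_unit]).
    Hence every integer k yields finitely many candidates y, given by
    coordinates which are generalised polynomials of k, and what remains is
    to test whether a candidate y is a power of beta.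

    Testing for powers of beta.  For y in Z[beta] let y' be its image under
    beta |-> 1/beta.  The conditions y y' = 1 and either floor(y') = 0 or
    y' = 1 are equations between generalised polynomials.  They force
    0 < y' <= 1 and make all conjugates of y other than y and y' unimodular,
    so that modulo powers of beta only finitely many such y exist.  It follows
    that y^k is a power beta^j for a fixed k ([unit_power]).  To descend from
    y^k to y, choose a modulus m such that beta^j = 1 modulo m implies that k
    divides j ([exponent_dvd]); if moreover y = 1 modulo m, then j = k l and
    y = beta^l, both being positive ([unit_one_mod]).  Congruence modulo m is
    again a condition on generalised polynomials: certain combinations of the
    coordinates are integers.

    The powers beta^(r i) pass the congruence when beta^r = 1 modulo m, and
    the other powers need not; so the test is applied to the r shifted
    sequences i |-> n(i + s) with s < r, each of which gives a generalised
    polynomial set between { n(r i + s) } and { n(i + s) }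
    ([gen_poly_sandwich]).  Their union is the set of values of n. *)

Set Implicit Arguments.
Unset Strict Implicit.
Unset Printing Implicit Defensive.

Import Order.TTheory GRing.Theory Num.Theory Pdiv.Ring.
Local Open Scope classical_set_scope.
Local Open Scope ring_scope.

(** * Generalised polynomial sets *)

Section GenPoly.
Variable R : realType.
Implicit Types (f g : int -> R) (E F : set int).

Lemma gen_poly_opp f : gen_poly f -> gen_poly (fun k => - f k).
Proof.
move=> gf; rewrite (_ : (fun k => - f k) = fun k => -1 * f k); last first.
  by apply/funext => k; rewrite mulN1r.
exact: gen_poly_mul (gen_poly_const _) gf.
Qed.

Lemma gen_poly_sub f g :
  gen_poly f -> gen_poly g -> gen_poly (fun k => f k - g k).
Proof. by move=> gf gg; apply: gen_poly_add => //; apply: gen_poly_opp. Qed.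

Lemma gen_poly_sum (I : Type) (r : seq I) (f : I -> int -> R) :
  (forall i, gen_poly (f i)) -> gen_poly (fun k => \sum_(i <- r) f i k).
Proof.
move=> gf; elim: r => [|i r IHr].
  rewrite (_ : (fun _ => _) = fun=> 0); first exact: gen_poly_const.
  by apply/funext => k; rewrite big_nil.
rewrite (_ : (fun _ => _) = fun k => f i k + \sum_(j <- r) f j k).
  exact: gen_poly_add.
by apply/funext => k; rewrite big_cons.
Qed.

Lemma gen_poly_setI E F :
  gen_poly_set R E -> gen_poly_set R F -> gen_poly_set R (E `&` F).
Proof. by rewrite /gen_poly_set indicI; exact: gen_poly_mul. Qed.

Lemma gen_poly_setC E : gen_poly_set R E -> gen_poly_set R (~` E).
Proof.
rewrite /gen_poly_set indicC => gE.
rewrite (_ : (fun _ => _) = fun k => 1 - \1_E k).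
  by apply: gen_poly_sub => //; exact: gen_poly_const.
by apply/funext => k; rewrite indicE; case: (k \in E); rewrite ?subrr ?subr0.
Qed.

Lemma gen_poly_setU E F :
  gen_poly_set R E -> gen_poly_set R F -> gen_poly_set R (E `|` F).
Proof.
move=> gE gF; rewrite -[_ `|` _]setCK setCU.
by apply/gen_poly_setC/gen_poly_setI; apply: gen_poly_setC.
Qed.

Lemma gen_poly_set_exists (I : finType) (E : I -> set int) :
  (forall i, gen_poly_set R (E i)) ->
  gen_poly_set R [set k | exists i, E i k].
Proof.
move=> gE; suff gEr (r : seq I) :
    gen_poly_set R [set k | exists2 i, i \in r & E i k].
  rewrite (_ : [set k | _] = [set k | exists2 i, i \in enum I & E i k]) //.
  by apply/seteqP; split=> k /= -[j]; exists j; rewrite ?mem_enum.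
elim: r => [|i r IHr].
  rewrite (_ : [set _ | _] = set0); last by apply/seteqP; split=> k //= [].
  by rewrite /gen_poly_set indic0; exact: gen_poly_const.
rewrite (_ : [set _ | _] = E i `|` [set k | exists2 i, i \in r & E i k]).
  exact: gen_poly_setU.
apply/seteqP; split=> k /=.
  by case=> j; rewrite inE => /predU1P[->|jr] Ejk; [left|right; exists j].
by case=> [Eik|[j jr Ejk]]; [exists i|exists j]; rewrite // inE ?eqxx ?jr ?orbT.
Qed.

Lemma gen_poly_set_forall (I : finType) (E : I -> set int) :
  (forall i, gen_poly_set R (E i)) ->
  gen_poly_set R [set k | forall i, E i k].
Proof.
move=> gE; rewrite (_ : [set _ | _] = ~` [set k | exists i, ~ E i k]).
  apply/gen_poly_setC/(gen_poly_set_exists (E := fun i => ~` E i)) => i.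
  exact: gen_poly_setC.
apply/seteqP; split=> k /=; first by move=> Ek [j]; apply.
by move/forallNP=> Ek i; apply: contrapT; exact: Ek.
Qed.

Lemma gen_poly_set_int f :
  gen_poly f -> gen_poly_set R [set k | f k \is a Num.int].
Proof.
move=> gf; rewrite /gen_poly_set.
(* the fractional part x of f k lies in [0, 1), so floor (1 - x) is 1 exactly
   when x = 0 *)
rewrite (_ : \1_ _ =
    fun k => (Num.floor (1 - (f k - (Num.floor (f k))%:~R)))%:~R).
  apply/gen_poly_floor/gen_poly_sub; first exact: gen_poly_const.
  by apply: gen_poly_sub => //; exact: gen_poly_floor.
apply/funext => k; rewrite indicE.
have /andP[le_fl lt_fl] := floor_itv (f k).
case: (boolP (f k \is a Num.int)) => fk.
  rewrite mem_set // ; move: fk; rewrite intrEfloor => /eqP ->.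
  by rewrite subrr subr0 floor1.
rewrite memNset; last exact/negP.
have {}le_fl : (Num.floor (f k))%:~R < f k.
  by rewrite lt_neqAle le_fl andbT -intrEfloor.
rewrite (_ : Num.floor (1 - _) = 0) //; apply/eqP.
rewrite -[_ == 0]/(_ == 0%Z) floor_eq; move: lt_fl; rewrite intrD => lt_fl.
by apply/andP; split; lra.
Qed.

(** A real number x vanishes exactly when x and theta x are both integers, for
    an irrational theta; so zero sets reduce to integrality tests. *)
Lemma gen_poly_set_eq (theta : R) f g :
  (forall q : rat, ratr q != theta) -> gen_poly f -> gen_poly g ->
  gen_poly_set R [set k | f k = g k].
Proof.
move=> irr gf gg; have gfg := gen_poly_sub gf gg.
rewrite (_ : [set _ | _] = [set k | f k - g k \is a Num.int] `&`
  [set k | theta * (f k - g k) \is a Num.int]).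
  apply: gen_poly_setI; first exact: gen_poly_set_int.
  by apply/gen_poly_set_int/gen_poly_mul => //; exact: gen_poly_const.
apply/seteqP; split=> k /=; first by move=> ->; rewrite subrr mulr0.
case=> /intrP[a fga] /intrP[b tfgb]; apply/subr0_eq/eqP/negPn/negP => fg0.
have /eqP[] := irr (b%:~R / a%:~R).
by rewrite fmorph_div /= !ratr_int -tfgb -fga mulfK.
Qed.

End GenPoly.

(** * Integer polynomials evaluated at beta, and congruences modulo m *)

Lemma nat_pigeonhole (T : finType) (f : nat -> T) :
  exists i j, [/\ (i < j)%N, (j <= #|T|)%N & f i = f j].
Proof.
have /injectivePn[i [j ij fij]] : ~~ injectiveb (fun i : 'I_#|T|.+1 => f i).
  by apply/injectiveP => /leq_card; rewrite card_ord ltnn.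
have [lt_ij|lt_ji|/val_inj eq_ij] := ltngtP i j; last by rewrite eq_ij eqxx in ij.
  by exists i, j; split; rewrite // -ltnS.
by exists j, i; split; rewrite // -ltnS.
Qed.

(** The element f(x), for any commutative ring containing x.  Elements of
    Z[beta] are handled as values [ev beta f], so that [ev z f] at another root
    z of the minimal polynomial is the corresponding conjugate. *)
Definition ev (K : comNzRingType) (x : K) (f : {poly int}) : K :=
  (map_poly intr f).[x].

HB.instance Definition _ (K : comNzRingType) (x : K) :=
  GRing.RMorphism.copy (ev x) (horner_eval x \o map_poly intr).

Section Evaluation.
Variables (K : comNzRingType) (x : K).

Lemma evX : ev x 'X = x.
Proof. by rewrite /ev map_polyX hornerX. Qed.

Lemma evC c : ev x c%:P = c%:~R.
Proof. by rewrite /ev map_polyC hornerC. Qed.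

Lemma ev_morph (L : comNzRingType) (phi : {rmorphism K -> L}) f :
  phi (ev x f) = ev (phi x) f.
Proof.
rewrite /ev -horner_map -map_poly_comp; congr (_.[_]).
by apply: eq_map_poly => c /=; rewrite rmorph_int.
Qed.

Lemma ev_comp f g : ev x (f \Po g) = ev (ev x g) f.
Proof. by rewrite /ev map_comp_poly horner_comp. Qed.

Lemma ev_coef N (f : {poly int}) : (size f <= N)%N ->
  ev x f = \sum_(k < N) (f`_k)%:~R * x ^+ k.
Proof.
move=> fN; rewrite /ev (@horner_coef_wide _ N); last first.
  exact: leq_trans (size_poly _ _) fN.
by apply: eq_bigr => k _; rewrite coef_map.
Qed.

End Evaluation.

Section MinimalPolynomial.
Variables (F : numFieldType) (beta : F) (P : {poly int}).
Hypotheses (P_monic : P \is monic) (P_beta : ev beta P = 0).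
Hypothesis P_min :
  forall f : {poly int}, (size f < size P)%N -> ev beta f = 0 -> f = 0.

Lemma ev_rmodp (K : comNzRingType) (z : K) f :
  ev z P = 0 -> ev z (rmodp f P) = ev z f.
Proof.
move=> Pz; rewrite [in RHS](Pdiv.RingMonic.rdivp_eq P_monic f).
by rewrite rmorphD rmorphM /= Pz mulr0 add0r.
Qed.

Lemma size_rmodp f : (size (rmodp f P) < size P)%N.
Proof. by rewrite Pdiv.Ring.ltn_rmodp monic_neq0. Qed.

(** The embedding Z[beta] -> K sending beta to a conjugate z is well defined:
    relations between values at beta hold at z. *)
Lemma ev_conj (K : comNzRingType) (z : K) f g :
  ev z P = 0 -> ev beta f = ev beta g -> ev z f = ev z g.
Proof.
move=> Pz fg; apply/subr0_eq; rewrite -rmorphB /= -ev_rmodp //.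
by rewrite (P_min (size_rmodp _)) ?rmorph0 // ev_rmodp // rmorphB /= fg subrr.
Qed.

Lemma ev_inj (f g : {poly int}) : (size f < size P)%N -> (size g < size P)%N ->
  ev beta f = ev beta g -> f = g.
Proof.
move=> sf sg fg; apply/subr0_eq/P_min; last by rewrite rmorphB /= fg subrr.
by rewrite (leq_ltn_trans (size_polyD _ _)) // size_polyN gtn_max sf sg.
Qed.

Lemma ev_coord g :
  exists2 f : {poly int}, (size f < size P)%N & ev beta f = ev beta g.
Proof. by exists (rmodp g P); rewrite ?size_rmodp ?ev_rmodp. Qed.

Definition one_mod (m : nat) (x : F) : Prop :=
  exists h, x = 1 + m%:R * ev beta h.

Lemma one_mod1 m : one_mod m 1.
Proof. by exists 0; rewrite rmorph0 mulr0 addr0. Qed.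

Lemma one_modM m x y : one_mod m x -> one_mod m y -> one_mod m (x * y).
Proof.
move=> [f ->] [g ->]; exists (f + g + m%:R * f * g).
by rewrite !rmorphD /= !rmorphM /= rmorph_nat; ring.
Qed.

Lemma one_modX m x i : one_mod m x -> one_mod m (x ^+ i).
Proof.
move=> x1; elim: i => [|i IHi]; first by rewrite expr0; exact: one_mod1.
by rewrite exprS; exact: one_modM.
Qed.

Lemma one_mod_dvd m m' x : (m %| m')%N -> one_mod m' x -> one_mod m x.
Proof.
move=> /dvdnP[q ->] [f ->]; exists (q%:R * f).
by rewrite (rmorphM (ev beta)) /= rmorph_nat natrM; ring.
Qed.

Lemma one_mod_cancel m f y :
  one_mod m (ev beta f * y) -> one_mod m y -> one_mod m (ev beta f).
Proof.
move=> [g fy] [h y1]; exists (g - f * h); rewrite rmorphB rmorphM /=.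
apply: (@addIr _ (m%:R * ev beta h * ev beta f)).
by transitivity (ev beta f * y); [rewrite y1|rewrite fy]; ring.
Qed.

(** Bezout, with natural exponents: u i = v j + gcd(i, j), and the factor with
    exponent v j cancels modulo m. *)
Lemma one_mod_gcd m f i j :
  (0 < i)%N -> one_mod m (ev beta f ^+ i) -> one_mod m (ev beta f ^+ j) ->
  one_mod m (ev beta f ^+ gcdn i j).
Proof.
move=> i0 fi fj; case: (egcdnP j i0) => u v uv _.
rewrite -rmorphXn; apply: (@one_mod_cancel _ _ (ev beta f ^+ (v * j))).
  by rewrite rmorphXn -exprD addnC -uv mulnC exprM; exact: one_modX.
by rewrite mulnC exprM; exact: one_modX.
Qed.

(** x^p - 1 = (x - 1)(1 + x + ... + x^(p-1)): the first factor is divisible by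
    m, the second is congruent to p modulo p. *)
Lemma one_mod_lift m p x :
  (p %| m)%N -> one_mod m x -> one_mod (m * p) (x ^+ p).
Proof.
move=> pm x1.
have sumE n : exists h, \sum_(i < n) x ^+ i = n%:R + p%:R * ev beta h.
  elim: n => [|n [h hE]].
    by exists 0; rewrite big_ord0 (rmorph0 (ev beta)) mulr0 addr0.
  have [f fE] := one_mod_dvd pm (one_modX n x1).
  exists (h + f); rewrite big_ord_recr /= hE fE (rmorphD (ev beta)) /= -natr1.
  by ring.
have [h hE] := sumE p.
case: x1 => f fE; exists (f * (1 + h)).
apply: (@addIr _ (-1)); rewrite subrX1 hE fE (rmorphM (ev beta)) /=.
rewrite (rmorphD (ev beta)) rmorph1 natrM /=.
by ring.
Qed.

(** Z[beta] is a free Z-module of finite rank, so only 0 is divisible by every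
    power of p. *)
Lemma one_mod_expn_eq1 p f : (1 < p)%N ->
  (forall a, one_mod (p ^ a) (ev beta f)) -> ev beta f = 1.
Proof.
move=> p1 fp; have [g sg gE] := ev_coord (f - 1).
suff g0 : g = 0.
  by apply/subr0_eq; rewrite -(rmorph1 (ev beta)) -rmorphB /= -gE g0 rmorph0.
apply/polyP => k; rewrite coef0; apply/eqP/negPn/negP => gk0.
have [a aE] : exists a, a = absz g`_k by eexists.
have [h0 h0E] := fp a; have [h sh hE] := ev_coord h0.
have gh : g = (p ^ a)%N%:Z *: h.
  apply: ev_inj => //; first exact: leq_ltn_trans (size_scale_leq _ _) sh.
  rewrite gE rmorphB rmorph1 /= h0E addrC addKr -mul_polyC rmorphM /= evC -hE.
  by rewrite pmulrn.
have gk : g`_k = (p ^ a)%N%:Z * h`_k by rewrite [in LHS]gh coefZ.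
have : (a < a)%N.
  rewrite [X in (_ < X)%N]aE gk abszM (leq_trans (ltn_expl _ p1)) // leq_pmulr //.
  by rewrite absz_gt0; apply: contraNneq gk0 => hk; rewrite gk hk mulr0.
by rewrite ltnn.
Qed.

(** Two powers of beta share their coordinates modulo m, by pigeonhole, and
    beta is invertible in Z[beta]. *)
Lemma one_mod_order (w : {poly int}) m :
  beta != 0 -> ev beta w = beta^-1 -> (0 < m)%N ->
  exists2 r, (0 < r)%N & one_mod m (beta ^+ r).
Proof.
move=> b0 wE; case: m => // m _.
pose c i : {poly int} := rmodp 'X^i P.
have cE i : ev beta (c i) = beta ^+ i by rewrite ev_rmodp // rmorphXn /= evX.
pose f i : {ffun 'I_(size P) -> 'I_m.+1} :=
  [ffun k => inord `|((c i)`_(k : 'I__) %% m.+1)%Z|].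
have [i [j [lt_ij _ fij]]] := nat_pigeonhole f.
exists (j - i)%N; first by rewrite subn_gt0.
pose h := \poly_(k < size P) (((c j)`_k - (c i)`_k) %/ m.+1)%Z.
have hE : c j = c i + m.+1%:Z *: h.
  apply/polyP => k; rewrite coefD coefZ coef_poly.
  case: ifPn => [kP|]; last first.
    rewrite -leqNgt mulr0 addr0 => kP.
    by rewrite !nth_default // (leq_trans (ltnW (size_rmodp _))).
  suff dvd_m : (m.+1 %| (c j)`_k - (c i)`_k)%Z.
    by rewrite [X in _ = _ + X]mulrC (divzK dvd_m) addrC subrK.
  rewrite -eqz_mod_dvd; apply/eqP.
  have /ffunP/(_ (Ordinal kP)) := fij; rewrite !ffunE /=.
  have lt_m a : (`|(a %% m.+1)%Z| < m.+1)%N.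
    by rewrite -ltz_nat gez0_abs ?modz_ge0 // ltz_pmod.
  move/(congr1 (@nat_of_ord _)); rewrite !inordK // => eq_abs.
  by rewrite -[LHS]gez0_abs -1?[RHS]gez0_abs ?modz_ge0 // eq_abs.
exists (w ^+ i * h).
apply: (mulfI (expf_neq0 i b0)); rewrite -exprD subnKC 1?ltnW //.
rewrite -cE hE rmorphD /= cE -mul_polyC rmorphM /= evC rmorphM rmorphXn /= wE.
rewrite mulrDr mulr1 exprVn mulrCA; congr (_ + _).
by rewrite mulVKf ?expf_neq0 // pmulrn.
Qed.

End MinimalPolynomial.

(** * Recognizing powers of a Salem number *)

Section Salem.
Variables (R : realType) (beta : R) (P : {poly int}) (d : nat).
Variable a : 'I_d -> R[i].
Hypotheses (P_monic : P \is monic) (P_size : size P = d.+1).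
Hypothesis P_beta : ev beta P = 0.
Hypothesis P_min :
  forall f : {poly int}, (size f < size P)%N -> ev beta f = 0 -> f = 0.
Hypotheses (beta_gt1 : 1 < beta) (P_inv : ev beta^-1 P = 0).
Hypotheses (a_inj : injective a) (a_root : forall i, ev (a i) P = 0).
Hypothesis a_abs :
  forall i, [\/ a i = (beta%:C)%C, a i = (beta^-1%:C)%C | `|a i| = 1].

Let beta_gt0 : 0 < beta. Proof. exact: lt_trans ltr01 beta_gt1. Qed.
Let beta_neq0 : beta != 0. Proof. exact: lt0r_neq0. Qed.

(** Since P is monic, beta^(d-1) P(1/beta) is 1/beta plus an integer polynomial
    in beta. *)
Lemma inv_poly : exists w : {poly int}, ev beta w = beta^-1.
Proof.
have := P_inv; rewrite (@ev_coef _ _ d.+1) ?P_size // big_ord_recr /=.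
rewrite (_ : P`_d = 1); last by rewrite -[d in P`_d]/(d.+1.-1) -P_size; exact/eqP.
have [d0|d_gt0] := posnP d.
  rewrite big1 ?add0r => [|k _]; last first.
    by have := leq_ltn_trans (leq0n k) (ltn_ord k); rewrite [X in (_ < X)%N]d0.
  by rewrite d0 mul1r expr0 => /eqP; rewrite oner_eq0.
rewrite mul1r => /eqP; rewrite addr_eq0 => /eqP sumE.
exists (- \sum_(k < d) P`_k *: 'X^(d.-1 - k)).
rewrite rmorphN rmorph_sum /=.
rewrite (eq_bigr (fun k : 'I_d => beta ^+ d.-1 * ((P`_k)%:~R * beta^-1 ^+ k))).
  rewrite -mulr_sumr sumE mulrN opprK -{2}(prednK d_gt0) exprS mulrCA exprVn.
  by rewrite mulfV ?mulr1 // expf_neq0.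
move=> k _; rewrite -mul_polyC rmorphM rmorphXn /= evC evX mulrCA; congr (_ * _).
have kd : (k <= d.-1)%N by rewrite -ltnS prednK.
by rewrite -[in RHS](subnK kd) exprD exprVn mulfK // expf_neq0.
Qed.

(** The property is multiplicative in k, which reduces it to k = p prime with
    beta replaced by g = beta^k'.  Let o > 0 satisfy beta^o = 1 modulo p, and pick
    e with g^o not congruent to 1 modulo p^e, which exists since g^o is not 1.
    The modulus p^e works: g^(o p^e) = 1 modulo p^e by lifting, so if g^i = 1
    modulo p^e with p not dividing i, then gcd(i, o p^e) divides o and
    g^o = 1 modulo p^e, a contradiction. *)
Lemma exponent_dvd k : (0 < k)%N ->
  exists2 m, (0 < m)%N & forall j, one_mod beta m (beta ^+ j) -> (k %| j)%N.
Proof.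
have [w wE] := inv_poly.
elim/ltn_ind: k => k IHk k_gt0; have [k_le1|k_gt1] := leqP k 1.
  by exists 1%N => // j _; rewrite (eqP (_ : k == 1%N)) ?dvd1n // eqn_leq k_le1.
set p := pdiv k; have p_pr : prime p := pdiv_prime k_gt1.
have p_gt0 := prime_gt0 p_pr.
have [k' kE] : exists k', k = (k' * p)%N by apply/dvdnP/pdiv_dvd.
have k'_gt0 : (0 < k')%N by move: k_gt0; rewrite kE muln_gt0 => /andP[].
have [|m1 m1_gt0 m1E] := IHk k' _ k'_gt0.
  by rewrite kE ltn_Pmulr // prime_gt1.
have xE i : beta ^+ i = ev beta 'X^i by rewrite rmorphXn /= evX.
have [o o_gt0 oE] := one_mod_order P_monic P_beta beta_neq0 wE p_gt0.
have [e eE] : exists e, ~ one_mod beta (p ^ e) (beta ^+ (k' * o)).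
  apply/existsNP => eE.
  have := one_mod_expn_eq1 P_monic P_beta P_min (f := 'X^(k' * o)) (prime_gt1 p_pr).
  rewrite -xE => /(_ eE)/eqP; rewrite gt_eqF //.
  by rewrite exprn_egt1 // -lt0n muln_gt0 k'_gt0.
exists (m1 * p ^ e)%N; first by rewrite muln_gt0 m1_gt0 expn_gt0 p_gt0.
move=> j jE.
have /dvdnP[i jiE] : (k' %| j)%N.
  by apply/m1E/(one_mod_dvd _ jE); rewrite dvdn_mulr.
rewrite jiE kE mulnC dvdn_pmul2r //; apply: contra_notT eE => p_i.
have i_gt0 : (0 < i)%N by case: i {jiE} p_i => //; rewrite dvdn0.
have iE : one_mod beta (p ^ e) (ev beta 'X^k' ^+ i).
  by rewrite -xE -exprM mulnC -jiE; apply: (one_mod_dvd _ jE); rewrite dvdn_mull.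
have lift e' : one_mod beta (p ^ e'.+1) (ev beta 'X^k' ^+ (o * p ^ e')).
  elim: e' => [|e' IHe].
    by rewrite muln1 expn1 -xE -exprM mulnC exprM; exact: one_modX.
  rewrite [X in one_mod _ X _]expnSr (_ : o * _ = o * p ^ e' * p)%N; last first.
    by rewrite expnSr mulnA.
  by rewrite exprM; apply: one_mod_lift => //; rewrite dvdn_exp.
have opE : one_mod beta (p ^ e) (ev beta 'X^k' ^+ (o * p ^ e)).
  by apply: (one_mod_dvd _ (lift e)); rewrite dvdn_exp2l.
have := one_mod_gcd i_gt0 iE opE; rewrite Gauss_gcdl; last first.
  by rewrite coprimeXr // coprime_sym prime_coprime.
have /dvdnP[q oq] := dvdn_gcdr i o => gE.
by rewrite [o in (k' * o)%N]oq (mulnC q) mulnA !exprM xE; exact: one_modX.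
Qed.

Let V : 'M[R[i]]_d := Vandermonde d (\row_l a l).

Lemma Vandermonde_unit : V \in unitmx.
Proof.
rewrite unitmxE det_Vandermonde unitfE; apply/prodf_neq0 => k _.
apply/prodf_neq0 => l kl; rewrite !mxE subr_eq0 (inj_eq a_inj).
by apply: contraTneq kl => ->; rewrite ltnn.
Qed.

Lemma coef_interpolation (f : {poly int}) (k : 'I_d) : (size f <= d)%N ->
  (f`_k)%:~R = \sum_l ev (a l) f * invmx V l k.
Proof.
move=> sf; pose c : 'rV[R[i]]_d := \row_k (f`_k)%:~R.
have cV : c *m V = \row_l ev (a l) f.
  apply/rowP => l; rewrite !mxE (ev_coef _ sf).
  by apply: eq_bigr => j _; rewrite !mxE.
have := congr1 (fun A => (A *m invmx V) 0 k) cV.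
rewrite mulmxK ?Vandermonde_unit // !mxE => ->.
by apply: eq_bigr => l _; rewrite !mxE.
Qed.

Lemma complex_bound (z : R[i]) : exists M : nat, `|z| <= M%:R.
Proof.
exists (Num.bound (Normc.normc z)).
have -> : `|z| = (Normc.normc z)%:C%C by [].
rewrite -(rmorph_nat (real_complex R)) lecR ltW // archi_boundP //.
by case: (z) => x y; rewrite sqrtr_ge0.
Qed.

(** Finitely many elements of Z[beta] have all their conjugates bounded by B:
    the coordinates are fixed linear forms in the conjugates. *)
Lemma coef_bounded (B : nat) : exists M : nat, forall f : {poly int},
  (size f <= d)%N -> (forall l, `|ev (a l) f| <= B%:R) ->
  forall k, (absz (f`_k)%R <= M)%N.
Proof.
have [M leM] := complex_bound (\sum_(k < d) \sum_l B%:R * `|invmx V l k|).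
exists M => f sf fB k.
have [dk|kd] := leqP d k; first by rewrite nth_default // (leq_trans sf).
rewrite -(ler_nat R[i]) natr_absz intr_norm (coef_interpolation (Ordinal kd)) //=.
apply: le_trans (ler_norm_sum _ _ _) (le_trans _ leM).
rewrite ger0_norm; last by do 2!(apply: sumr_ge0 => ? _); rewrite mulr_ge0.
rewrite [leRHS](bigD1 (Ordinal kd)) //= ler_wpDr //.
  by do 2!(apply: sumr_ge0 => ? _); rewrite mulr_ge0.
by apply: ler_sum => l _; rewrite normrM ler_wpM2r.
Qed.


(** Here w is a polynomial expressing 1/beta in Z[beta]; it then inverts every
    conjugate of beta. *)
Lemma mul_ev_inv_poly (w : {poly int}) (K : comNzRingType) (z : K) :
  ev beta w = beta^-1 -> ev z P = 0 -> z * ev z w = 1.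
Proof.
move=> wE zP; have : ev z ('X * w) = ev z 1.
  apply: (ev_conj P_monic P_beta P_min) => //.
  by rewrite rmorphM /= evX wE mulfV // rmorph1.
by rewrite rmorphM rmorph1 /= evX.
Qed.

Lemma ev_inv_poly (w : {poly int}) (K : fieldType) (z : K) :
  ev beta w = beta^-1 -> ev z P = 0 -> ev z w = z^-1.
Proof.
move=> wE zP; have zw := mul_ev_inv_poly wE zP.
rewrite -[RHS]mulr1 -zw mulKf //.
by apply: contra_eq_neq zw => ->; rewrite mul0r eq_sym oner_eq0.
Qed.

(** The equation y y' = 1, where y' is the image of y under the automorphism
    beta |-> 1/beta.  On embeddings at unimodular roots this automorphism is
    complex conjugation, so the equation says that |y| = 1 there. *)
Definition reciprocal_unit y := ev beta y * ev beta^-1 y = 1.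

Lemma reciprocal_conj y (K : fieldType) (z : K) :
  reciprocal_unit y -> ev z P = 0 -> ev z y * ev z^-1 y = 1.
Proof.
have [w wE] := inv_poly => y1 zP; rewrite -(ev_inv_poly wE zP) -ev_comp.
rewrite -rmorphM -(rmorph1 (ev z)).
apply: (ev_conj P_monic P_beta P_min) zP _.
by rewrite rmorphM rmorph1 /= ev_comp wE.
Qed.

Lemma reciprocal_norm y (z : R[i]) :
  reciprocal_unit y -> ev z P = 0 -> `|z| = 1 -> `|ev z y| = 1.
Proof.
move=> y1 zP z1; have zV : z^-1 = conjc z.
  by rewrite invc_norm z1 expr1n invr1 mul1r.
have := reciprocal_conj y1 zP; rewrite zV -ev_morph /= -sqr_normc => /eqP.
by rewrite pexpr_eq1 // => /eqP.
Qed.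

Lemma log_floor (x : R) : 1 <= x ->
  exists t, beta ^+ t <= x < beta ^+ t.+1.
Proof.
move=> x1.
have ex_t : exists t, x < beta ^+ t.
  have bernoulli t : 1 + t%:R * (beta - 1) <= beta ^+ t.
    elim: t => [|t IHt]; first by rewrite mul0r addr0.
    rewrite exprS -natr1; have := ler_wpM2l (ltW beta_gt0) IHt.
    apply: le_trans; have : 0 <= t%:R * (beta - 1) ^+ 2 by rewrite mulr_ge0 ?sqr_ge0.
    by nra.
  exists (Num.bound (x / (beta - 1))); apply: lt_le_trans (bernoulli _).
  have x_ge0 : 0 <= x / (beta - 1).
    by rewrite divr_ge0 ?subr_ge0 ?(ltW beta_gt1) ?(le_trans ler01 x1).
  have := archi_boundP x_ge0; rewrite ltr_pdivrMr ?subr_gt0 // => /lt_trans; apply.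
  by rewrite ltrDr ltr01.
case: (ex_minnP ex_t) => -[|t] xt t_min; first by move: xt; rewrite expr0 ltNge x1.
exists t; rewrite xt andbT leNgt; apply/negP => /t_min.
by rewrite ltnn.
Qed.

(** Let u be a unit as above.  For each s take t with beta^t <= u^s < beta^(t+1).
    The elements u^s / beta^t have all conjugates bounded by a constant B that
    does not depend on u, so they lie in a finite set whose size N does not
    either.  Two of them coincide for some i < j <= N, which makes u^(j-i) a
    power of beta, and j - i divides k = N!. *)
Lemma unit_power : exists2 k, (0 < k)%N & forall y, reciprocal_unit y ->
  0 <= ev beta^-1 y <= 1 -> exists j, ev beta y ^+ k = beta ^+ j.
Proof.
have [w wE] := inv_poly.
pose B := Num.bound beta.
have B_beta : beta < B%:R by rewrite archi_boundP // ltW.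
have B_ge1 : 1 <= B%:R :> R by rewrite ltW // (lt_trans beta_gt1).
have [M coefM] := coef_bounded B.
pose T : finType := {ffun 'I_d -> 'I_(2 * M).+1}.
exists (#|T|)`!; first exact: fact_gt0.
move=> y y1; set u := ev beta y; set v := ev beta^-1 y => /andP[v_ge0 v_le1].
have uv : u * v = 1 := y1.
have v_gt0 : 0 < v.
  rewrite lt_neqAle v_ge0 andbT; apply: contra_eq_neq uv => <-.
  by rewrite mulr0 eq_sym oner_eq0.
have uE : u = v^-1 by rewrite -[RHS]mul1r -uv mulfK // lt0r_neq0.
have u_ge1 : 1 <= u by rewrite uE invf_ge1.
have /choice[t tE] : forall s, exists t, beta ^+ t <= u ^+ s < beta ^+ t.+1.
  by move=> s; apply/log_floor/exprn_ege1.
pose z s : {poly int} := rmodp (y ^+ s * w ^+ t s) P.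
have zE (K : fieldType) (x : K) s :
    ev x P = 0 -> ev x (z s) = ev x y ^+ s * x^-1 ^+ t s.
  by move=> xP; rewrite ev_rmodp // rmorphM !rmorphXn /= (ev_inv_poly wE xP).
have sz s : (size (z s) <= d)%N by rewrite -ltnS -P_size size_rmodp.
have evR (x : R) f : ev x%:C%C f = (ev x f)%:C%C.
  by rewrite -(ev_morph _ (real_complex R)).
have zB s l : `|ev (a l) (z s)| <= B%:R.
  have /andP[tl tu] := tE s.
  have normR (x : R) : 0 <= x -> x <= B%:R -> `|x%:C%C| <= B%:R :> R[i].
    by move=> x0 xB; rewrite ger0_norm ?ler0c // -(rmorph_nat (real_complex R)) lecR.
  case: (a_abs l) => [->|->|al1].
  - rewrite evR zE // normR ?mulr_ge0 ?exprn_ge0 ?invr_ge0 ?(ltW beta_gt0) //;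
      rewrite ?(le_trans ler01 u_ge1) //.
    apply: (le_trans _ (ltW B_beta)).
    by rewrite exprVn ler_pdivrMr ?exprn_gt0 // -exprS ltW.
  - rewrite evR zE // invrK normR ?mulr_ge0 ?exprn_ge0 ?(ltW beta_gt0) //.
    apply: (le_trans _ B_ge1); rewrite -/v -[v]invrK -uE exprVn.
    by rewrite mulrC ler_pdivrMr ?mul1r // exprn_gt0 // (lt_le_trans ltr01).
  rewrite zE // normrM !normrX normfV al1 (reciprocal_norm y1) //.
  by rewrite invr1 !expr1n mulr1 -(rmorph_nat (real_complex R)) (lecR 1).
(* coordinates lie in [-M, M] and are shifted into 'I_(2M+1) *)
pose f s : T := [ffun k : 'I_d => inord (absz ((z s)`_k + M)%R)].
have [i [j [lt_ij jT fij]]] := nat_pigeonhole f.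
have zij : z i = z j.
  apply/polyP => k; have [dk|kd] := leqP d k.
    by rewrite !nth_default // (leq_trans (sz _)).
  have /ffunP/(_ (Ordinal kd)) := fij; rewrite !ffunE /=.
  have zM s : (absz ((z s)`_k + M)%R < (2 * M).+1)%N /\ 0 <= (z s)`_k + M.
    have := coefM _ (sz s) (zB s) k; move: (_`_k) => c; clear; split; lia.
  move/(congr1 (@nat_of_ord _)); rewrite !inordK ?(zM _).1 // => eq_abs.
  apply: (@addIr _ M%:Z); rewrite -[LHS]gez0_abs ?(zM _).2 //.
  by rewrite -[RHS]gez0_abs ?(zM _).2 // eq_abs.
have uij : u ^+ (j - i) * beta ^+ t i = beta ^+ t j.
  have := congr1 (ev beta) zij; rewrite !zE // -/u.
  rewrite -[X in _ = u ^+ X * _](subnK (ltnW lt_ij)) exprD.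
  have u_neq0 : u != 0 by rewrite lt0r_neq0 // (lt_le_trans ltr01).
  rewrite -mulrA mulrCA => /(mulfI (expf_neq0 i u_neq0)) e.
  rewrite -[u ^+ (j - i)](mulfVK (expf_neq0 (t j) beta_neq0)) -exprVn -e.
  by rewrite mulrAC exprVn mulVf ?mul1r ?expf_neq0.
have [q ->] : exists q, ((#|T|)`! = (j - i) * q)%N.
  have /dvdnP[q ->] : (j - i %| (#|T|)`!)%N.
    by rewrite dvdn_fact // subn_gt0 lt_ij (leq_trans (leq_subr _ _)).
  by exists q; rewrite mulnC.
exists ((t j - t i) * q)%N; rewrite !exprM; congr (_ ^+ _).
have tij : (t i <= t j)%N.
  rewrite -(ler_eXn2l beta_gt1) -uij ler_peMl ?exprn_ge0 ?(ltW beta_gt0) //.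
  exact: exprn_ege1.
apply: (mulIf (expf_neq0 (t i) beta_neq0)).
by rewrite uij -exprD subnK.
Qed.

Lemma unit_one_mod : exists2 m, (0 < m)%N & forall y, reciprocal_unit y ->
  0 <= ev beta^-1 y <= 1 -> one_mod beta m (ev beta y) ->
  exists l, ev beta y = beta ^+ l.
Proof.
have [k k_gt0 kE] := unit_power; have [m m_gt0 mE] := exponent_dvd k_gt0.
exists m => // y y1 y_le1 ym; have [j jE] := kE y y1 y_le1.
have /dvdnP[l jl] : (k %| j)%N by apply: mE; rewrite -jE; exact: one_modX.
exists l; apply/eqP; rewrite -(@eqrXn2 _ k) ?exprn_ge0 ?(ltW beta_gt0) //.
  by rewrite jE jl exprM.
have /andP[v_ge0 _] := y_le1; move: y1; rewrite /reciprocal_unit.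
case: ltP => // u_lt0 uv; have := mulr_le0_ge0 (ltW u_lt0) v_ge0.
by rewrite uv ler10.
Qed.

End Salem.

(** * Linear recurrences and Hankel matrices *)

Section ShiftAction.
Variable K : comNzRingType.
Implicit Types (f g : {poly K}) (u : nat -> K).

(** The polynomial f acting on sequences through the shift operator; a sequence
    satisfies the recurrence with characteristic polynomial p when p acts on
    it as zero. *)
Definition shift_act f u (j : nat) : K := \sum_(k < size f) f`_k * u (k + j)%N.

Lemma shift_act_wide N f u j : (size f <= N)%N ->
  shift_act f u j = \sum_(k < N) f`_k * u (k + j)%N.
Proof.
move=> fN; rewrite /shift_act (big_ord_widen N (fun k => f`_k * u (k + j)%N)) //.
rewrite big_mkcond.
by apply: eq_bigr => k _; case: ltnP => // /(nth_default _)->; rewrite mul0r.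
Qed.

Lemma shift_actD f g u j :
  shift_act (f + g) u j = shift_act f u j + shift_act g u j.
Proof.
set N := maxn (size f) (size g).
rewrite !(@shift_act_wide N) ?size_polyD ?leq_maxl ?leq_maxr // -big_split.
by apply: eq_bigr => k _; rewrite coefD mulrDl.
Qed.

Lemma shift_actZ c f u j : shift_act (c *: f) u j = c * shift_act f u j.
Proof.
rewrite (@shift_act_wide (size f)) ?size_scale_leq // mulr_sumr.
by apply: eq_bigr => k _; rewrite coefZ mulrA.
Qed.

Lemma shift_actMX f u j : shift_act (f * 'X) u j = shift_act f u j.+1.
Proof.
have sfX : (size (f * 'X)%R <= (size f).+1)%N.
  by rewrite (leq_trans (size_polyMleq _ _)) // size_polyX addn2.
rewrite (shift_act_wide _ _ sfX) big_ord_recl coefMX mul0r add0r.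
by apply: eq_bigr => k _; rewrite coefMX /= addSnnS.
Qed.

Lemma shift_act0 u j : shift_act 0 u j = 0.
Proof. by rewrite /shift_act size_poly0 big_ord0. Qed.

Lemma shift_act1 u j : shift_act 1 u j = u j.
Proof. by rewrite /shift_act size_poly1 big_ord1 coefC mul1r. Qed.

Lemma shift_actXn i u j : shift_act 'X^i u j = u (i + j)%N.
Proof.
elim: i j => [|i IHi] j; first by rewrite shift_act1.
by rewrite exprSr shift_actMX IHi addSnnS.
Qed.

Lemma shift_actM f g u j :
  shift_act (f * g) u j = shift_act f (shift_act g u) j.
Proof.
elim/poly_ind: f j => [|f c IHf] j; first by rewrite mul0r !shift_act0.
rewrite mulrDl mulrAC mul_polyC -[c%:P]mulr1 mul_polyC !shift_actD !shift_actMX.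
by rewrite !shift_actZ shift_act1 IHf.
Qed.

Lemma shift_act_eq0 f u j : (forall i, u i = 0) -> shift_act f u j = 0.
Proof. by move=> u0; rewrite /shift_act big1 // => k _; rewrite u0 mulr0. Qed.

End ShiftAction.

(** The numbers [(rmodp 'X^i P)`_k] are the coordinates of beta^i in the basis
    of powers of beta, and 'X^i acts as the shift by i. *)
Lemma recurrence_coords (P : {poly int}) (n : nat -> int) i j :
  P \is monic -> (forall i, shift_act P n i = 0) ->
  n (i + j)%N = \sum_(k < (size P).-1) (rmodp 'X^i P)`_k * n (k + j)%N.
Proof.
move=> P_monic nP; rewrite -[LHS]shift_actXn.
rewrite [in LHS](Pdiv.RingMonic.rdivp_eq P_monic 'X^i) shift_actD shift_actM.
rewrite shift_act_eq0 // add0r (@shift_act_wide _ (size P).-1) //.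
by rewrite -ltnS prednK ?size_rmodp // size_poly_gt0 monic_neq0.
Qed.

Definition hankel (K : comNzRingType) (d : nat) (u : nat -> K) : 'M[K]_d :=
  \matrix_(k, j) u (k + j)%N.

(** A vector in the left kernel is a polynomial w of degree less than that of p
    whose action on u vanishes at d consecutive indices, hence everywhere since
    p annihilates it as well.  If w were nonzero it would be coprime to the
    irreducible p, and by Bezout 1 would annihilate u. *)
Lemma hankel_unit (F : fieldType) (p : {poly F}) (u : nat -> F) :
  irreducible_poly p -> (forall i, shift_act p u i = 0) ->
  (exists i, u i != 0) -> hankel (size p).-1 u \in unitmx.
Proof.
move=> p_irr pu [i ui]; set d := (size p).-1.
have p_size : size p = d.+1 by rewrite prednK // (leq_trans _ p_irr.1).
rewrite unitmxE unitfE; apply: contraNneq ui => /eqP/det0P[v v0 vH].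
pose w := rVpoly v.
have w0 j : shift_act w u j = 0.
  have w0d (k : 'I_d) : shift_act w u k = 0.
    have := congr1 (fun A : 'rV_d => A 0 k) vH; rewrite !mxE => <-.
    rewrite (@shift_act_wide _ d) ?size_poly //.
    by apply: eq_bigr => l _; rewrite coef_rVpoly_ord mxE.
  rewrite -[j]addn0 -shift_actXn (divp_eq 'X^j p) shift_actD shift_actM.
  rewrite shift_act_eq0 => [|l]; last first.
    by rewrite -shift_actM mulrC shift_actM shift_act_eq0.
  rewrite add0r (@shift_act_wide _ d); last first.
    by rewrite -ltnS -p_size ltn_modp irredp_neq0.
  by rewrite big1 // => k _; rewrite addn0 w0d mulr0.
have w_neq0 : w != 0.
  by apply: contraNneq v0 => w_eq0; rewrite -(rVpolyK v) -/w w_eq0 linear0.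
have : coprimep p w.
  rewrite irreducible_poly_coprime //; apply/negP => pw.
  have sw : (size w <= d)%N by exact: size_poly.
  by have := dvdp_leq w_neq0 pw; rewrite p_size ltnNge sw.
move=> /Bezout_coprimepP[[r s]] /=; rewrite eqp_sym.
move=> /eqpP[[c e] /= /andP[c0 e0] ce].
have : shift_act (c *: 1) u i = 0.
  rewrite ce shift_actZ shift_actD !shift_actM !shift_act_eq0 ?addr0 ?mulr0 //.
by rewrite shift_actZ shift_act1 => /eqP; rewrite mulf_eq0 (negPf c0).
Qed.

(** * Minimal polynomials and the conjugates of a Salem number *)

Lemma map_ratr_int (K : numFieldType) (f : {poly int}) :
  map_poly ratr (map_poly intr f : {poly rat}) = map_poly intr f :> {poly K}.
Proof.
by rewrite -map_poly_comp; apply: eq_map_poly => c /=; rewrite ratr_int.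
Qed.

Section MinPoly.
Variables (K : numFieldType) (x : K) (p : {poly rat}).
Hypothesis p_min : is_min_poly x p.

Lemma min_poly_dvd (q : {poly rat}) : root (map_poly ratr q) x -> p %| q.
Proof.
have [p_monic px p_le] := p_min => qx; rewrite /dvdp; apply/negPn/negP => r0.
suff rx : root (map_poly ratr (q %% p)) x.
  by have := p_le _ r0 rx; rewrite leqNgt ltn_modp monic_neq0.
move: qx; rewrite [in X in X -> _](divp_eq q p) rmorphD rmorphM /=.
by rewrite /root hornerD hornerM (rootP px) mulr0 add0r.
Qed.

Lemma min_poly_irreducible : irreducible_poly p.
Proof.
have [p_monic px p_le] := p_min.
have p_gt1 : (1 < size p)%N.
  rewrite ltnNge; apply/negP => /size1_polyC pE; move: px p_monic.
  rewrite pE map_polyC rootC monicE lead_coefC fmorph_eq0 => /eqP->.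
  by rewrite eq_sym oner_eq0.
split=> // q q1 /dvdpP[r pE]; have p0 := monic_neq0 p_monic.
have /andP[r0 q0] : (r != 0) && (q != 0).
  by move: p0; rewrite pE mulf_eq0 negb_or.
have := px; rewrite pE rmorphM rootM => /orP[/(p_le _ r0)|/min_poly_dvd pq].
  rewrite pE size_mul // => sz; exfalso.
  move: sz q1 q0 r0; rewrite -!size_poly_gt0.
  case: (size q) => [|[|m]] //; move: (size r) => k.
  by rewrite addnS /= addnS ltnNge leq_addr.
by rewrite -pE /eqp pq pE dvdp_mull.
Qed.

Lemma min_poly_unique q : is_min_poly x q -> q = p.
Proof.
move=> [q_monic qx q_le]; have [p_monic px p_le] := p_min.
apply/eqP; rewrite -eqp_monic // eqp_sym -dvdp_size_eqp ?min_poly_dvd //.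
by rewrite eqn_leq p_le ?q_le ?monic_neq0.
Qed.

Lemma min_poly_separable : separable_poly p.
Proof.
have p_irr := min_poly_irreducible; rewrite unlock irreducible_poly_coprime //.
have sp : size p = (size p).-2.+2 by case: (size p) p_irr.1 => [|[]].
have p'0 : p^`() != 0.
  have [p_monic _ _] := p_min; apply/eqP => /polyP/(_ (size p).-2).
  rewrite coef_deriv coef0 (_ : p`_ _ = 1); last first.
    by rewrite -(eqP p_monic) /lead_coef [in RHS]sp.
  by move=> /eqP; rewrite pnatr_eq0.
apply/negP => /(dvdp_leq p'0); rewrite leqNgt lt_size_deriv //.
exact: irredp_neq0.
Qed.

(** Gauss: p divides a monic integer polynomial, so up to a rational factor it
    is an integer polynomial with leading coefficient 1 or -1. *)
Lemma min_poly_int : integralOver (intr : int -> K) x ->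
  exists2 P : {poly int}, P \is monic & map_poly intr P = p.
Proof.
move=> [q q_monic qx]; have [p_monic _ _] := p_min.
have /min_poly_dvd/dvdpP_rat_int[P [a a0 pE] [r qE]] :
    root (map_poly ratr (map_poly intr q : {poly rat})) x.
  by rewrite map_ratr_int.
set e := lead_coef P; have ee : e * e = 1.
  have : e * lead_coef r = 1 by rewrite -lead_coefM -qE (eqP q_monic).
  by rewrite mulrC => /intUnitRing.unitzPl/orP[]/eqP->.
have ae : a * e%:~R = 1.
  rewrite -[RHS](eqP p_monic) pE lead_coefZ lead_coef_map_inj //.
  exact: intr_inj.
exists (e *: P); first by rewrite monicE lead_coefZ ee.
rewrite map_polyZ pE; congr (_ *: _).
have ee1 : (e%:~R * e%:~R : rat) = 1 by rewrite -intrM ee.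
by rewrite -[a]mulr1 -ee1 mulrA ae mul1r.
Qed.

End MinPoly.

Section SalemConjugates.
Variables (R : realType) (beta : R) (p : {poly rat}) (P : {poly int}).
Hypotheses (beta_salem : salem beta) (p_min : is_min_poly beta p).
Hypotheses (P_monic : P \is monic) (PE : map_poly intr P = p).

Lemma min_poly_ev_beta : ev beta P = 0.
Proof.
by have [_ /rootP px _] := p_min; rewrite /ev -(map_ratr_int R) PE.
Qed.

Lemma min_poly_ev f : ev beta f = 0 -> p %| map_poly intr f.
Proof.
move=> f0; apply: (min_poly_dvd p_min).
by rewrite map_ratr_int; apply/rootP.
Qed.

Lemma min_poly_small (f : {poly int}) :
  (size f < size P)%N -> ev beta f = 0 -> f = 0.
Proof.
move=> sf f0; apply: contraTeq sf => f_neq0; rewrite -leqNgt.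
have := dvdp_leq _ (min_poly_ev f0).
rewrite map_poly_eq0_id0 ?intr_eq0 ?lead_coef_eq0 // => /(_ f_neq0).
by rewrite -PE !size_map_inj_poly //; exact: intr_inj.
Qed.

Lemma conjugateE (z : R[i]) : conjugate beta z <-> ev z P = 0.
Proof.
split=> [[q q_min qz]|Pz].
  apply/rootP; rewrite -map_ratr_int PE.
  by rewrite -(min_poly_unique p_min q_min).
by exists p => //; rewrite -PE map_ratr_int; apply/rootP.
Qed.

(** A polynomial sharing a complex root with the irreducible p is divisible by
    p, hence vanishes at beta. *)
Lemma ev_common_root (z : R[i]) f : ev z P = 0 -> ev z f = 0 -> ev beta f = 0.
Proof.
move=> Pz fz; have p_irr := min_poly_irreducible p_min.
have : ~~ coprimep p (map_poly intr f).
  apply/negP => cop.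
  have : coprimep (map_poly ratr p : {poly R[i]}) (map_poly ratr (map_poly intr f)).
    by rewrite coprimep_map.
  rewrite -PE !map_ratr_int => /coprimep_root/(_ (introT rootP Pz)).
  by rewrite -[_.[z]]/(ev z f) fz eqxx.
rewrite irreducible_poly_coprime // negbK => /dvdpP[g fE].
have : ev beta f = (map_poly ratr (map_poly intr f : {poly rat})).[beta].
  by rewrite map_ratr_int.
rewrite fE rmorphM hornerM /= => ->.
by rewrite -PE map_ratr_int [X in _ * X]min_poly_ev_beta mulr0.
Qed.

(** For a conjugate z of modulus one, 1/z is the complex conjugate of z, hence
    a root of P; so z is a root of the reversed polynomial Q of P.  Then beta is
    a root of Q too. *)
Lemma salem_reciprocal : ev beta^-1 P = 0.
Proof.
have [_ beta_gt1 _ [z /conjugateE Pz z1]] := beta_salem.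
set d := (size P).-1; pose Q : {poly int} := \poly_(k < d.+1) P`_(d - k).
have sP : size P = d.+1 by rewrite prednK // size_poly_gt0 monic_neq0.
have evQ (K : fieldType) (x : K) : x != 0 -> ev x Q = x ^+ d * ev x^-1 P.
  move=> x0; rewrite (@ev_coef _ _ d.+1) ?size_poly // (@ev_coef _ x^-1 d.+1) ?sP //.
  rewrite mulr_sumr (reindex_inj rev_ord_inj) /=; apply: eq_bigr => k _.
  have kd : (k <= d)%N by rewrite -ltnS.
  rewrite subSS coef_poly ltnS leq_subr subKn // mulrCA; congr (_ * _).
  have -> : x ^+ d = x ^+ (d - k) * x ^+ k by rewrite -exprD subnK.
  by rewrite exprVn mulfK // expf_neq0.
have z0 : z != 0 by rewrite -normr_eq0 z1 oner_eq0.
have zV : z^-1 = conjc z by rewrite invc_norm z1 expr1n invr1 mul1r.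
have b0 : beta != 0 by rewrite lt0r_neq0 // (lt_trans ltr01).
have : ev beta Q = 0.
  by apply: (ev_common_root Pz); rewrite evQ // zV -ev_morph /= Pz rmorph0 mulr0.
by rewrite evQ // => /eqP; rewrite mulf_eq0 expf_eq0 (negPf b0) andbF => /eqP.
Qed.

(** Along with a root z other than beta and 1/beta, its inverse is a root
    different from beta; the defining bound applies to both z and 1/z. *)
Lemma salem_conjugates d : size P = d.+1 -> exists a : 'I_d -> R[i],
  [/\ injective a, forall l, ev (a l) P = 0 &
    forall l, [\/ a l = (beta%:C)%C, a l = (beta^-1%:C)%C | `|a l| = 1]].
Proof.
move=> sP; have [_ beta_gt1 conj_le1 _] := beta_salem.
have [r rE] := closed_field_poly_normal (map_poly intr P : {poly R[i]}).
have PC_monic : map_poly intr P \is @monic R[i] by rewrite monic_map.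
move: rE; rewrite (eqP PC_monic) scale1r => rE.
have r_uniq : uniq r.
  rewrite -separable_prod_XsubC -rE -map_ratr_int PE separable_map.
  exact: min_poly_separable p_min.
have sr : size r = d.
  have := congr1 (fun f : {poly _} => size f) rE.
  rewrite size_prod_XsubC size_map_inj_poly //; last exact: intr_inj.
  by rewrite sP => -[].
exists (fun l => r`_l).
have rP l : (l < d)%N -> ev r`_l P = 0.
  by rewrite -sr => lr; apply/rootP; rewrite rE root_prod_XsubC mem_nth.
split=> [k l /eqP|l|l].
- by rewrite nth_uniq ?sr // => /eqP/val_inj.
- exact: rP.
have := rP l (ltn_ord l); move: r`_l => z Pz.
have [->|z_beta] := eqVneq z (beta%:C)%C; first by constructor 1.
have [->|z_betaV] := eqVneq z (beta^-1%:C)%C; first by constructor 2.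
constructor 3; apply/eqP; rewrite eq_le; apply/andP; split.
  by apply: conj_le1 z_beta; apply/conjugateE.
have [w wE] := inv_poly P_monic sP beta_gt1 salem_reciprocal.
have zw := mul_ev_inv_poly P_monic min_poly_ev_beta min_poly_small beta_gt1 wE Pz.
have wzV := ev_inv_poly P_monic min_poly_ev_beta min_poly_small beta_gt1 wE Pz.
have PzV : ev z^-1 P = 0.
  rewrite -wzV -ev_comp -(rmorph0 (ev z)) /=.
  apply: (ev_conj P_monic min_poly_ev_beta min_poly_small) => //.
  by rewrite rmorph0 ev_comp wE salem_reciprocal.
have : `|z^-1| <= 1.
  apply: conj_le1; first exact/conjugateE.
  by apply: contraNneq z_betaV => zV; rewrite -[z]invrK zV fmorphV.
rewrite normfV invf_le1 // normr_gt0.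
by apply: contra_eq_neq zw => ->; rewrite mul0r eq_sym oner_eq0.
Qed.

End SalemConjugates.

(** * From a term of the sequence to a power of beta *)

Lemma shift_act_int (K : comNzRingType) (f : {poly int}) (n : nat -> int) i :
  (shift_act f n i)%:~R =
  shift_act (map_poly intr f) (fun j => (n j)%:~R : K) i.
Proof.
rewrite [RHS](@shift_act_wide _ (size f)) ?size_poly // rmorph_sum /=.
by apply: eq_bigr => k _; rewrite coef_map intrM.
Qed.

Lemma int_recurrence (p : {poly rat}) (P : {poly int}) (n : nat -> int) :
  map_poly intr P = p -> linear_recurrent p (fun i => (n i)%:~R) ->
  forall i, shift_act P n i = 0.
Proof.
move=> PE [m [a [pE rec]]] i; apply: (@intr_inj rat).
pose u i : rat := (n i)%:~R.
have {}rec i' : u (i' + m)%N = \sum_(j < m) a j * u (i' + j)%N := rec i'.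
rewrite shift_act_int PE -/u.
have XmE : 'X^m = p + \sum_(j < m) a j *: 'X^j by rewrite pE subrK.
have := shift_actXn m u i; rewrite XmE shift_actD.
rewrite (big_morph (fun f => shift_act f u i) (fun f g => shift_actD f g u i)
  (shift_act0 u i)) addnC rec => /eqP.
rewrite -subr_eq0 -addrA -sumrB big1 ?addr0 => [/eqP//|j _].
by rewrite shift_actZ shift_actXn addnC subrr.
Qed.

Section SalemRecurrence.
Variables (R : realType) (beta : R) (P : {poly int}) (d : nat).
Variable a : 'I_d -> R[i].
Hypotheses (P_monic : P \is monic) (P_size : size P = d.+1).
Hypothesis P_beta : ev beta P = 0.
Hypothesis P_min :
  forall f : {poly int}, (size f < size P)%N -> ev beta f = 0 -> f = 0.
Hypothesis P_irr : irreducible_poly (map_poly intr P : {poly rat}).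
Hypotheses (beta_gt1 : 1 < beta) (P_inv : ev beta^-1 P = 0).
Hypotheses (a_inj : injective a) (a_root : forall i, ev (a i) P = 0).
Hypothesis a_abs :
  forall i, [\/ a i = (beta%:C)%C, a i = (beta^-1%:C)%C | `|a i| = 1].

Let beta_gt0 : 0 < beta. Proof. exact: lt_trans ltr01 beta_gt1. Qed.
Let beta_neq0 : beta != 0. Proof. exact: lt0r_neq0. Qed.

(** A rational number is fixed by beta |-> 1/beta. *)
Lemma salem_irrational (q : rat) : ratr q != beta.
Proof.
apply/eqP => qb; pose f : {poly int} := denq q *: 'X - (numq q)%:P.
have fE (x : R) : ev x f = (denq q)%:~R * x - (numq q)%:~R.
  by rewrite rmorphB /= evC -mul_polyC rmorphM /= evC evX.
have f0 : ev beta f = 0.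
  rewrite fE -qb -{2}[q]divq_num_den fmorph_div /= !ratr_int mulrC divfK ?subrr //.
  by rewrite intr_eq0 denq_neq0.
have := ev_conj P_monic P_beta P_min P_inv (etrans f0 (esym (rmorph0 (ev beta)))).
rewrite rmorph0 -f0 !fE => /addIr/mulfI; rewrite intr_eq0 denq_neq0 => /(_ isT) bV.
by have := beta_gt1; rewrite -invf_lt1 // bV lt_gtF.
Qed.

Variable n : nat -> int.
Hypothesis n_rec : forall i, shift_act P n i = 0.

Lemma recurrence_coord_sum i j :
  n (i + j)%N = \sum_(k < d) (rmodp 'X^i P)`_k * n (k + j)%N.
Proof. by rewrite (recurrence_coords i j P_monic n_rec) P_size. Qed.

(** With n(i) = sum_l c_l a_l^i over the roots a_l of P, the difference is
    sum_l c_l (a_l^j - beta^j) a_l^i; the term of the root beta cancels and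
    every other root has modulus at most one. *)
Lemma growth_bound : exists M : nat, forall i (j : 'I_d),
  `|(n (i + j))%:~R - beta ^+ j * (n i)%:~R| <= M%:R :> R.
Proof.
pose V := Vandermonde d (\row_l a l); pose c l := \sum_k invmx V l k * (n k)%:~R.
have nE i : (n i)%:~R = \sum_l c l * a l ^+ i.
  rewrite -[i in LHS]addn0 recurrence_coord_sum rmorph_sum /=.
  under [RHS]eq_bigr => l _ do rewrite mulr_suml.
  rewrite exchange_big /=; apply: eq_bigr => k _.
  have sX : (size (rmodp 'X^i P) <= d)%N by rewrite -ltnS -P_size size_rmodp.
  rewrite intrM (coef_interpolation a_inj k sX) mulr_suml.
  apply: eq_bigr => l _.
  by rewrite ev_rmodp // rmorphXn /= evX addn0; ring.
have [M leM] := complex_bound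
  (\sum_(j < d) \sum_l `|c l| * `|a l ^+ j - ((beta ^+ j)%:C)%C|).
exists M => i j.
rewrite -lecR (rmorph_nat (real_complex R)).
have normR (x : R) : (`|x|%:C)%C = `|(x%:C)%C|.
  by rewrite normc_def /= expr0n addr0 sqrtr_sqr.
rewrite normR rmorphB rmorphM /= !rmorph_int !nE mulr_sumr -sumrB.
apply: le_trans (ler_norm_sum _ _ _) (le_trans _ leM).
rewrite ger0_norm; last by do 2!(apply: sumr_ge0 => ? _); rewrite mulr_ge0.
rewrite [leRHS](bigD1 j) //= ler_wpDr //.
  by do 2!(apply: sumr_ge0 => ? _); rewrite mulr_ge0.
apply: ler_sum => l _.
have -> : c l * a l ^+ (i + j) - ((beta ^+ j)%:C)%C * (c l * a l ^+ i) =
    a l ^+ i * (c l * (a l ^+ j - ((beta ^+ j)%:C)%C)).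
  by rewrite exprD; ring.
rewrite normrM -(normrM (c l)); case: (a_abs l) => [->|alE|al1].
- by rewrite rmorphXn subrr mulr0 normr0 mulr0.
- rewrite ler_piMl // normrX exprn_ile1 // alE -normR lecR.
  by rewrite ger0_norm ?invf_le1 ?invr_ge0 ?ltW.
by rewrite normrX al1 expr1n mul1r.
Qed.


(** The set consists of the k that pass the test below for some vector c of
    rounding errors: [N c k] is the candidate state with first entry k, [Y c k]
    the candidate coordinates, and the four conditions are the consistency of
    the first entry, the congruence to 1 modulo m, y y' = 1, and y' in [0, 1].
    A genuine term n(r i) passes; conversely a candidate passing the test is a
    power of beta, which determines its state and gives k as a term of n. *)
Lemma gen_poly_sandwich (m r : nat) : (0 < m)%N -> one_mod beta m (beta ^+ r) ->
  (forall y, reciprocal_unit beta y -> 0 <= ev beta^-1 y <= 1 ->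
    one_mod beta m (ev beta y) -> exists l, ev beta y = beta ^+ l) ->
  exists E : set int, [/\ gen_poly_set R E, forall i, E (n (r * i)%N) &
    forall k, E k -> exists i, n i = k].
Proof.
move=> m_gt0 r1 m_unit.
(* the Hankel matrix degenerates for the zero sequence, whose set is {0} *)
have [[i0 ni0]|n0] := pselect (exists i, n i != 0); last first.
  have {}n0 i : n i = 0 by apply/eqP/negPn/negP => ni0; apply: n0; exists i.
  exists [set k | k%:~R = 0 :> R]; split=> [|i /=|k /= /eqP].
  - by apply: (gen_poly_set_eq salem_irrational) (gen_poly_id _) (gen_poly_const _).
  - by rewrite n0.
  - by rewrite intr_eq0 => /eqP->; exists 0%N.
have m_neq0 : m%:R != 0 :> R by rewrite pnatr_eq0 -lt0n.
have d_gt0 : (0 < d)%N.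
  rewrite lt0n; apply/eqP => d0; have P1 : size P = 1%N by rewrite P_size d0.
  have := P_beta; have := P_monic; rewrite (size1_polyC (eq_leq P1)).
  by rewrite monicE lead_coefC evC => /eqP -> /eqP; rewrite oner_eq0.
pose o := Ordinal d_gt0.
pose H : 'M[R]_d := hankel d (fun i => (n i)%:~R).
have H_unit : H \in unitmx.
  have -> : H = map_mx ratr (hankel d (fun i => (n i)%:~R : rat)).
    by apply/matrixP => k l; rewrite !mxE ratr_int.
  have dE : (size (map_poly intr P : {poly rat})).-1 = d.
    by rewrite size_map_inj_poly ?P_size //; exact: intr_inj.
  rewrite map_unitmx -dE; apply: hankel_unit => // [i|].
    by rewrite -shift_act_int n_rec.
  by exists i0; rewrite intr_eq0.
have [M leM] := growth_bound.
(* the errors lie in [-M, M + 1] and are stored shifted by M + 1 *)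
pose C : finType := {ffun 'I_d -> 'I_(2 * M.+1).+1}.
pose N (c : C) k : 'rV[R]_d := \row_(j < d)
  ((Num.floor (beta ^+ j * k%:~R))%:~R + ((c j)%:Z - M.+1%:Z)%:~R).
pose Y c k := N c k *m invmx H.
have YH c k : Y c k *m H = N c k by rewrite mulmxKV.
have NY c k (f : {poly int}) i : (forall l : 'I_d, Y c k 0 l = (f`_l)%:~R) ->
  f = rmodp 'X^i P -> forall j : 'I_d, N c k 0 j = (n (i + j)%N)%:~R.
  move=> YE fE j; rewrite -YH mxE recurrence_coord_sum rmorph_sum /=.
  by apply: eq_bigr => l _; rewrite YE fE mxE intrM.
pose y (x : R) c k := \sum_(l < d) Y c k 0 l * x ^+ l.
(* the coordinates of 1 *)
pose delta (l : nat) : R := (l == 0)%:R.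
have deltaE (l : nat) : ((l == 0)%:R : int)%:~R = delta l.
  by rewrite /delta; case: eqP.
pose test c k := [/\ N c k 0 o = k%:~R,
  forall l : 'I_d, (Y c k 0 l - delta l) / m%:R \is a Num.int,
  y beta c k * y beta^-1 c k = 1 &
  (Num.floor (y beta^-1 c k))%:~R * (y beta^-1 c k - 1) = 0].
have yE x c k (f : {poly int}) : (size f <= d)%N ->
    (forall l : 'I_d, Y c k 0 l = (f`_l)%:~R) -> y x c k = ev x f.
  by move=> sf YE; rewrite (ev_coef _ sf); apply: eq_bigr => l _; rewrite YE.
exists [set k | exists c, test c k]; split.
- apply: (gen_poly_set_exists (E := fun c => [set k | test c k])) => c.
  have gN j : gen_poly (fun k => N c k 0 j).
    rewrite (_ : (fun k => _) = fun k => (Num.floor (beta ^+ j * k%:~R))%:~R +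
        ((c j)%:Z - M.+1%:Z)%:~R); last by apply/funext => k; rewrite mxE.
    apply: gen_poly_add; last exact: gen_poly_const.
    by apply/gen_poly_floor/gen_poly_mul; [exact: gen_poly_const|exact: gen_poly_id].
  have gY l : gen_poly (fun k => Y c k 0 l).
    rewrite (_ : (fun k => _) = fun k => \sum_j N c k 0 j * invmx H j l); last first.
      by apply/funext => k; rewrite mxE.
    by apply: gen_poly_sum => j; apply: gen_poly_mul => //; exact: gen_poly_const.
  have gy x : gen_poly (y x c).
    by apply: gen_poly_sum => l; apply: gen_poly_mul => //; exact: gen_poly_const.
  have g_eq (f g : int -> R) :
      gen_poly f -> gen_poly g -> gen_poly_set R [set k | f k = g k].
    exact: (gen_poly_set_eq salem_irrational).
  rewrite (_ : [set k | _] = [set k | N c k 0 o = k%:~R] `&`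
    [set k | forall l : 'I_d, (Y c k 0 l - delta l) / m%:R \is a Num.int] `&`
    [set k | y beta c k * y beta^-1 c k = 1] `&`
    [set k | (Num.floor (y beta^-1 c k))%:~R * (y beta^-1 c k - 1) = 0]); last first.
    by apply/seteqP; split=> k /= => [[]|[[[]]]].
  apply: gen_poly_setI; first apply: gen_poly_setI; first apply: gen_poly_setI.
  + by apply: g_eq => //; exact: gen_poly_id.
  + apply: (gen_poly_set_forall (E := fun l : 'I_d => [set k | _])) => l.
    apply: gen_poly_set_int; apply: gen_poly_mul; last exact: gen_poly_const.
    by apply: gen_poly_sub => //; exact: gen_poly_const.
  + by apply: g_eq; [exact: gen_poly_mul|exact: gen_poly_const].
  + apply: g_eq; last exact: gen_poly_const.
    apply: gen_poly_mul; first exact: gen_poly_floor.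
    by apply: gen_poly_sub => //; exact: gen_poly_const.
- move=> i /=; set s := (r * i)%N; set k := n s.
  pose x (j : 'I_d) : R := beta ^+ j * k%:~R.
  pose e (j : 'I_d) : int := n (s + j)%N - Num.floor (x j) + M.+1%:Z.
  have e_bound j : 0 <= e j /\ (absz (e j) < (2 * M.+1).+1)%N.
    have /andP[fl_le fl_gt] := floor_itv (x j).
    have := leM s j; rewrite ler_norml -/k -/(x j) => /andP[tx_ge tx_le].
    have e_ge : (- M%:Z) <= n (s + j)%N - Num.floor (x j).
      rewrite -(ler_int R) intrN intrB; apply: le_trans tx_ge _.
      by rewrite lerD2l lerN2.
    have e_lt : n (s + j)%N - Num.floor (x j) < M%:Z + 1.
      rewrite -(ltr_int R) intrB intrD; move: fl_gt; rewrite intrD.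
      by rewrite -pmulrn => ?; lra.
    rewrite /e; move: (n _ - _) e_ge e_lt => t; clear; split; lia.
  pose c : C := [ffun j => inord (absz (e j))]; exists c.
  have NE j : N c k 0 j = (n (s + j)%N)%:~R.
    rewrite mxE ffunE inordK ?(e_bound j).2 // gez0_abs ?(e_bound j).1 //.
    by rewrite -/(x j) -intrD /e addrK addrC subrK.
  set b := rmodp 'X^s P.
  have sb : (size b <= d)%N by rewrite -ltnS -P_size size_rmodp.
  have YE (l : 'I_d) : Y c k 0 l = (b`_l)%:~R.
    have bH : N c k = (\row_(l < d) (b`_l)%:~R) *m H.
      apply/rowP => j; rewrite NE mxE recurrence_coord_sum rmorph_sum /=.
      by apply: eq_bigr => l' _; rewrite !mxE intrM.
    by rewrite /Y bH mulmxK // mxE.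
  have ybE z : ev z P = 0 -> y z c k = z ^+ s.
    by move=> zP; rewrite (yE _ _ _ _ sb YE) ev_rmodp // rmorphXn /= evX.
  split.
  + by rewrite NE addn0.
  + have [h0 h0E] := one_modX i r1.
    have [h sh hE] := ev_coord P_monic P_beta h0.
    have bE : b = 1 + m%:Z *: h.
      apply: (ev_inj P_min); rewrite ?size_rmodp //.
        rewrite (leq_ltn_trans (size_polyD _ _)) // gtn_max size_poly1.
        rewrite P_size ltnS d_gt0.
        by rewrite (leq_ltn_trans (size_scale_leq _ _)) // -P_size.
      rewrite ev_rmodp // rmorphXn /= evX exprM h0E rmorphD rmorph1 /=.
      by rewrite -mul_polyC rmorphM /= evC hE.
    move=> l; rewrite YE bE coefD coef1 coefZ intrD intrM.
    by rewrite deltaE addrAC subrr add0r -pmulrn mulrC mulKf // intr_int.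
  + by rewrite !ybE // -exprMn mulfV // expr1n.
  rewrite ybE //; case: s {c x e e_bound NE b sb YE ybE} k => [|s] k.
    by rewrite expr0 subrr mulr0.
  rewrite (_ : Num.floor _ = 0) ?mul0r //; apply/eqP; rewrite floor_eq.
  rewrite exprn_ge0 ?invr_ge0 ?(ltW beta_gt0) // add0r.
  by rewrite exprn_ilt1 ?invr_ge0 ?invf_lt1 ?(ltW beta_gt0).
- move=> k /= [c [Nk Yint y1 y_fl]].
  have /choice[h hE] : forall l : 'I_d, exists a : int,
      (Y c k 0 l - delta l) / m%:R = a%:~R by move=> l; apply/intrP.
  pose hp : {poly int} := rVpoly (\row_l h l).
  pose f : {poly int} := 1 + m%:Z *: hp.
  have shp : (size hp <= d)%N by exact: size_poly.
  have sf : (size f <= d)%N.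
    rewrite (leq_trans (size_polyD _ _)) // geq_max size_poly1 d_gt0.
    by rewrite (leq_trans (size_scale_leq _ _)).
  have YE (l : 'I_d) : Y c k 0 l = (f`_l)%:~R.
    rewrite coefD coef1 coefZ coef_rVpoly_ord [in RHS]mxE intrD intrM -hE -pmulrn.
    by rewrite deltaE [m%:R * _]mulrC divfK // addrC subrK.
  rewrite !(yE _ _ _ _ sf YE) in y1 y_fl.
  have [] := m_unit f y1.
  + move/eqP: y_fl; rewrite mulf_eq0 intr_eq0 floor_eq subr_eq0.
    by case/orP=> [/andP[-> /ltW]|/eqP->]; rewrite ?ler01 ?lexx // add0r.
  + by exists hp; rewrite rmorphD rmorph1 -mul_polyC rmorphM /= evC.
  move=> l lE; exists l.
  have fE : f = rmodp 'X^l P.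
    apply: (ev_inj P_min); rewrite ?size_rmodp ?P_size //.
    by rewrite ev_rmodp // rmorphXn /= evX.
  have := NY _ _ _ _ YE fE o; rewrite Nk addn0 => /intr_inj ->.
  by [].
Qed.
End SalemRecurrence.

Theorem theoremA (R : realType) (beta : R) (p : {poly rat}) (n : nat -> int)
    (beta_salem : salem beta)
    (p_min : is_min_poly beta p)
    (n_rec : linear_recurrent p (fun i => (n i)%:~R)) :
  gen_poly_set R [set n i | i in [set: nat]].
Proof.
have [beta_int beta_gt1 _ _] := beta_salem.
have [P P_monic PE] := min_poly_int p_min beta_int.
have P_beta := min_poly_ev_beta p_min PE.
have P_min := min_poly_small p_min PE.
have P_size : size P = (size P).-1.+1.
  by rewrite prednK // size_poly_gt0 monic_neq0.
have P_inv := salem_reciprocal beta_salem p_min P_monic PE.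
have [a [a_inj a_root a_abs]] :=
  salem_conjugates beta_salem p_min P_monic PE P_size.
have P_irr : irreducible_poly (map_poly intr P : {poly rat}).
  by rewrite PE; exact: min_poly_irreducible p_min.
have {}n_rec := int_recurrence PE n_rec.
have [m m_gt0 m_unit] := unit_one_mod P_monic P_size P_beta P_min beta_gt1
  P_inv a_inj a_root a_abs.
have beta_neq0 : beta != 0 by rewrite lt0r_neq0 // (lt_trans ltr01).
have [w wE] := inv_poly P_monic P_size beta_gt1 P_inv.
have [r r_gt0 r1] := one_mod_order P_monic P_beta beta_neq0 wE m_gt0.
have /choice[E E_spec] : forall s : 'I_r, exists E : set int,
    [/\ gen_poly_set R E, forall i, E (n (r * i + s)%N) &
      forall k, E k -> exists i, n (i + s)%N = k].
  move=> s; apply: (gen_poly_sandwich P_monic P_size P_beta P_min P_irr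
    beta_gt1 P_inv a_inj a_root a_abs (n := fun i => n (i + s)%N) _
    m_gt0 r1 m_unit) => i.
  rewrite -[RHS](n_rec (i + s)%N); apply: eq_bigr => k _.
  by rewrite addnA.
rewrite (_ : [set _ | _ in _] = [set k | exists s, E s k]).
  by apply: gen_poly_set_exists => s; have [] := E_spec s.
apply/seteqP; split=> k /=.
  move=> [i _ <-]; have i_mod : (i %% r < r)%N by rewrite ltn_mod.
  exists (Ordinal i_mod); have [_ /(_ (i %/ r)%N) + _] := E_spec (Ordinal i_mod).
  by rewrite /= mulnC -divn_eq.
by move=> [s Ek]; have [_ _ /(_ _ Ek)[i <-]] := E_spec s; exists (i + s)%N.
Qed.
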